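(* Let $n\ge1$. (1) The differential system $$f_j'=f_j\Big(\sum_{1\le r\le n}f_{j+2r-1}-\sum_{1\le r\le n}f_{j+2r}\Big)+\alpha_j\qquad(0\le j\le 2n)$$ of type $A^{(1)}_{2n}$ is equivalent, under the change of coordinates $q_i=f_{2i}$, $p_i=f_1+f_3+\cdots+f_{2i-1}$ ($i=1,\ldots,n$), $x=f_0+f_1+\cdots+f_{2n}$, to the Hamiltonian system $$\frac{dq_i}{dt}=\frac{\partial H}{\partial p_i},\qquad \frac{dp_i}{dt}=-\frac{\partial H}{\partial q_i}\qquad(i=1,\ldots,n)$$ with an auxiliary variable $x$ such that $dx/dt=k$, where $H=H(q;p;x)$ is the polynomial $$H=\Big(x-\sum_{i=1}^nq_i\Big)\Big(\sum_{i=1}^nq_ip_i\Big)-\sum_{i=1}^nq_ip_i^2-\sum_{1\le i<j\le n}q_i(p_i-p_j)q_j-\sum_{i=1}^n\Big(\sum_{r=1}^i\alpha_{2r-1}\Big)q_i+\sum_{i=1}^n\alpha_{2i}p_i+\beta x,$$ $$\beta=\frac{1}{2n+1}\sum_{r=1}^n\big((n+1-r)\alpha_{2r-1}-r\alpha_{2r}\big).$$ (2) The differential system $$f_j'=f_j\Big(\sum_{1\le r\le s\le n}f_{j+2r-1}f_{j+2s}-\sum_{1\le r\le s\le n}f_{j+2r}f_{j+2s+1}\Big)+\Big(\frac{k}{2}-\sum_{1\le r\le n}\alpha_{j+2r}\Big)f_j+\alpha_j\Big(\sum_{1\le r\le n}f_{j+2r}\Big)\qquad(0\le j\le 2n+1)$$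 of type $A^{(1)}_{2n+1}$ is equivalent, under the change of coordinates $x_0=f_0+f_2+\cdots+f_{2n}$, $x_1=f_1+f_3+\cdots+f_{2n+1}$, $q_i=x_0f_{2i}$, $p_i=x_0^{-1}(f_1+f_3+\cdots+f_{2i-1})$ ($i=1,\ldots,n$), to the Hamiltonian system $$\frac{dq_i}{dt}=\frac{\partial H}{\partial p_i},\qquad \frac{dp_i}{dt}=-\frac{\partial H}{\partial q_i}\qquad(i=1,\ldots,n)$$ with two auxiliary variables $x_0,x_1$ such that $dx_0/dt=kx_0/2$, $dx_1/dt=kx_1/2$, where $H=H(q;p;x)$ is the following polynomial in $(q;p)$: $$H=\Big(x_0^2-\sum_{i=1}^nq_i\Big)\Big(\sum_{i=1}^nq_ip_i\big(\tfrac{x_1}{x_0}-p_i\big)\Big)-\sum_{1\le i<j\le n}q_iq_j(p_i-p_j)\Big(\frac{x_1}{x_0}+p_i-p_j\Big)+2\gamma\sum_{i=1}^nq_ip_i-\frac{x_1}{x_0}\sum_{i=1}^n\beta_iq_i+x_0^2\sum_{i=1}^n\alpha_{2i}p_i+(\gamma-\varpi_{2n+1})x_0x_1+\gamma^2,$$ $$\beta_i=\sum_{r=1}^i\alpha_{2r-1},\qquad \gamma=\frac12\sum_{r=0}^n\alpha_{2r+1},\qquad \varpi_{2n+1}=\frac{1}{2n+2}\sum_{r=1}^{2n+1}r\,\alpha_r.$$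
   Context: In case (1) put $l=2n$, in case (2) put $l=2n+1$. Indices $j$ of $f_j,\alpha_j$ are understood modulo $l+1$. The $f_0,\ldots,f_l$ are the unknown functions of the independent variable $t$, with $'=d/dt$; the $\alpha_0,\ldots,\alpha_l$ are complex parameters (constants: $\alpha_j'=0$), and $k=\alpha_0+\cdots+\alpha_l$. Equivalently, $'$ may be regarded as the derivation on the field $\mathbb{C}(\alpha;f)$ of rational functions in the $\alpha_j$, $f_j$ determined by the stated formulas and $\alpha_j'=0$; in case (2) the coordinate change is birational, defined where $x_0\neq0$. *)

(* Defs.v *)
From HB Require Import structures.
From mathcomp Require Import all_boot all_order all_algebra.
From mathcomp Require Import complex.
From mathcomp Require Import all_classical all_reals all_analysis.

Set Implicit Arguments.
Unset Strict Implicit.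
Unset Printing Implicit Defensive.

Import Order.TTheory GRing.Theory Num.Theory.
Import numFieldNormedType.Exports.
Local Open Scope classical_set_scope.
Local Open Scope ring_scope.

(* [cyc f m] is f_m with the index m read modulo l + 1. *)
Definition cyc (T : Type) (l : nat) (f : 'I_l.+1 -> T) (m : nat) : T :=
  f (inZp m).

(* Canonical coordinates together with auxiliary variables of type X.
   Ordinals start at 0: [pos z i] is q_(i+1) and [mom z i] is p_(i+1). *)
Record phase (K X : Type) (n : nat) := Phase {
  pos : 'I_n -> K;
  mom : 'I_n -> K;
  aux : X }.

Section Systems.
Variable K : numFieldType.

Definition partial (n : nat) (F : ('I_n -> K) -> K) (v : 'I_n -> K)
    (i : 'I_n) : K :=
  derive1 (fun s : K => F (@dfwith _ (fun=> K) v i s)) (v i).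

(* [f : K -> 'I_l.+1 -> K] solves f_j' = V_j(f) on D; the derivative is taken
   with respect to a K-valued time, so it is the complex one for K = R[i]. *)
Definition solves (l : nat) (V : ('I_l.+1 -> K) -> 'I_l.+1 -> K) (D : set K)
    (f : K -> 'I_l.+1 -> K) : Prop :=
  forall t, D t -> forall j, is_derive t 1 (fun s => f s j) (V (f t) j).

Definition solves_hamilton (X : Type) (n : nat)
    (H : ('I_n -> K) -> ('I_n -> K) -> X -> K) (D : set K)
    (z : K -> phase K X n) : Prop :=
  forall t, D t -> forall i : 'I_n,
    let q := pos (z t) in let p := mom (z t) in let x := aux (z t) in
    is_derive t 1 (fun s => pos (z s) i) (partial (fun v => H q v x) p i) /\
    is_derive t 1 (fun s => mom (z s) i) (- partial (fun v => H v p x) q i).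

Section EvenRank. (* type A_(2n)^(1) *)
Variables (n : nat) (alpha : 'I_(2 * n).+1 -> K).

Definition vf_even (f : 'I_(2 * n).+1 -> K) (j : 'I_(2 * n).+1) : K :=
  f j * (\sum_(1 <= r < n.+1) cyc f (j + 2 * r - 1)%N
         - \sum_(1 <= r < n.+1) cyc f (j + 2 * r)%N)
  + alpha j.

Definition coord_even (f : 'I_(2 * n).+1 -> K) : phase K K n :=
  Phase (fun i : 'I_n => cyc f (2 * i.+1)%N)
        (fun i : 'I_n => \sum_(1 <= r < i.+2) cyc f (2 * r - 1)%N)
        (\sum_j f j).

Definition beta_even : K :=
  (2 * n + 1)%:R^-1 *
  \sum_(1 <= r < n.+1) ((n + 1 - r)%:R * cyc alpha (2 * r - 1)%N
                        - r%:R * cyc alpha (2 * r)%N).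

Definition H_even (q p : 'I_n -> K) (x : K) : K :=
  (x - \sum_i q i) * (\sum_i q i * p i)
  - \sum_i q i * p i ^+ 2
  - \sum_(i < n) \sum_(j < n | (i < j)%N) q i * (p i - p j) * q j
  - \sum_(i < n) (\sum_(1 <= r < i.+2) cyc alpha (2 * r - 1)%N) * q i
  + \sum_(i < n) cyc alpha (2 * i.+1)%N * p i
  + beta_even * x.

Definition solves_even_hamilton (D : set K) (z : K -> phase K K n) : Prop :=
  solves_hamilton H_even D z /\
  forall t, D t -> is_derive t 1 (fun s => aux (z s)) (\sum_j alpha j).

End EvenRank.

Section OddRank. (* type A_(2n+1)^(1) *)
Variables (n : nat) (alpha : 'I_(2 * n).+2 -> K).

Let k : K := \sum_j alpha j.

Definition vf_odd (f : 'I_(2 * n).+2 -> K) (j : 'I_(2 * n).+2) : K :=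
  f j * (\sum_(1 <= r < n.+1) \sum_(r <= s < n.+1)
           cyc f (j + 2 * r - 1)%N * cyc f (j + 2 * s)%N
         - \sum_(1 <= r < n.+1) \sum_(r <= s < n.+1)
             cyc f (j + 2 * r)%N * cyc f (j + 2 * s + 1)%N)
  + (k / 2 - \sum_(1 <= r < n.+1) cyc alpha (j + 2 * r)%N) * f j
  + alpha j * \sum_(1 <= r < n.+1) cyc f (j + 2 * r)%N.

Definition x0_odd (f : 'I_(2 * n).+2 -> K) : K :=
  \sum_(0 <= r < n.+1) cyc f (2 * r)%N.

Definition x1_odd (f : 'I_(2 * n).+2 -> K) : K :=
  \sum_(0 <= r < n.+1) cyc f (2 * r + 1)%N.

(* The auxiliary variables are the pair (x_0, x_1). *)
Definition coord_odd (f : 'I_(2 * n).+2 -> K) : phase K (K * K) n :=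
  Phase (fun i : 'I_n => x0_odd f * cyc f (2 * i.+1)%N)
        (fun i : 'I_n =>
           (x0_odd f)^-1 * \sum_(1 <= r < i.+2) cyc f (2 * r - 1)%N)
        (x0_odd f, x1_odd f).

Definition beta_odd (i : 'I_n) : K :=
  \sum_(1 <= r < i.+2) cyc alpha (2 * r - 1)%N.

Definition gamma_odd : K :=
  2^-1 * \sum_(0 <= r < n.+1) cyc alpha (2 * r + 1)%N.

Definition varpi_odd : K :=
  (2 * n + 2)%:R^-1 * \sum_(1 <= r < (2 * n).+2) r%:R * cyc alpha r.

Definition H_odd (q p : 'I_n -> K) (x : K * K) : K :=
  let x0 := x.1 in let x1 := x.2 in
  (x0 ^+ 2 - \sum_i q i) * (\sum_i q i * p i * (x1 / x0 - p i))
  - \sum_(i < n) \sum_(j < n | (i < j)%N)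
      q i * q j * (p i - p j) * (x1 / x0 + p i - p j)
  + 2 * gamma_odd * (\sum_i q i * p i)
  - x1 / x0 * (\sum_i beta_odd i * q i)
  + x0 ^+ 2 * (\sum_(i < n) cyc alpha (2 * i.+1)%N * p i)
  + (gamma_odd - varpi_odd) * x0 * x1
  + gamma_odd ^+ 2.

Definition solves_odd_hamilton (D : set K) (z : K -> phase K (K * K) n)
    : Prop :=
  solves_hamilton H_odd D z /\
  forall t, D t ->
    is_derive t 1 (fun s => (aux (z s)).1) (k * (aux (z t)).1 / 2) /\
    is_derive t 1 (fun s => (aux (z s)).2) (k * (aux (z t)).2 / 2).

End OddRank.

End Systems.

(* Main.v *)
Require Import Defs.
From HB Require Import structures.
From mathcomp Require Import all_boot all_order all_algebra.
From mathcomp Require Import complex ring zify.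
From mathcomp Require Import all_classical all_reals all_analysis.

Set Implicit Arguments.
Unset Strict Implicit.
Unset Printing Implicit Defensive.

Import Order.TTheory GRing.Theory Num.Theory.
Import numFieldNormedType.Exports.
Local Open Scope classical_set_scope.
Local Open Scope ring_scope.

(** In both cases the change of coordinates is, up to scaling by x_0, a linear
map of f: the q_i are entries of even index and the p_i are sums of the first
i entries of odd index.  Everything is therefore expressed by the partial sums
T(m) = f_0 + f_2 + ... + f_(2m-2) and S(m) = f_1 + f_3 + ... + f_(2m-1).

On the side of the f_j, the cyclic sums of the vector field are sums over
windows of consecutive even or odd indices, hence differences of values of T
and S; wrapping around the cycle only adds the full sums to T and S (and, when
the period 2n+1 is odd, exchanges them).  The double sums of the odd rank case
reduce in the same way to T, S and one more quantity,
W(m) = sum over r < m of f_(2r) S(r), because the companion sum of the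
f_(2r+1) T(r+1) is T(m) S(m) - W(m) by Abel summation.  This gives closed
formulas for the vector field V (vf_even_at_even, vf_even_at_odd,
vf_odd_at_even, vf_odd_at_odd), which sum up telescopically to closed formulas
for the partial sums of V (evens_vf_even, odds_vf_even, evens_vf_odd,
odds_vf_odd).  For the full sums they say that the auxiliary variables have the
required derivatives.

On the side of the Hamiltonian, the partial derivatives are polynomials whose
sums run over indices above or below the one considered, so they too become
expressions in T, S and W.  Comparing the two sides is then an identity of
polynomials or of rational functions (hamilton_pos_even, hamilton_mom_even,
hamilton_pos_odd, hamilton_mom_odd): at any f, with x_0 nonzero in odd rank,
the Hamiltonian vector field at the coordinates of f is the image of V(f) under
the differential of the coordinate change.

Finally the coordinate change has an explicit inverse, a linear decoding
composed with the scaling by x_0.  Differentiating it turns derivatives of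
the coordinates into derivatives of the f_j, which gives the implication from
the Hamiltonian system to the system in f.  In odd rank the decoding recovers
f only where x_0 does not vanish, and openness of D makes this hold near each
of its points. *)

(** * Differentiation rules *)

Section Calculus.
Variable K : numFieldType.
Implicit Types (f g : K -> K) (t a b c : K).

(** [is_derive] is a type class; behind this constant the premises of the rules
below stay ordinary subgoals, as the tactic [derive_rules] requires. *)
Definition has_deriv t f a : Prop := is_derive t 1 f a.

Lemma has_deriv_eq t f a b : has_deriv t f a -> a = b -> has_deriv t f b.
Proof. by move=> h <-. Qed.

Lemma has_deriv_const t c : has_deriv t (fun=> c) 0.
Proof. exact: is_derive_cst. Qed.

Lemma has_deriv_add t f g a b : has_deriv t f a -> has_deriv t g b ->
  has_deriv t (fun s => f s + g s) (a + b).
Proof. exact: is_deriveD. Qed.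

Lemma has_deriv_sub t f g a b : has_deriv t f a -> has_deriv t g b ->
  has_deriv t (fun s => f s - g s) (a - b).
Proof. exact: is_deriveB. Qed.

Lemma has_deriv_mul t f g a b : has_deriv t f a -> has_deriv t g b ->
  has_deriv t (fun s => f s * g s) (f t * b + g t * a).
Proof. exact: is_deriveM. Qed.

Lemma has_deriv_inv t f a : f t != 0 -> has_deriv t f a ->
  has_deriv t (fun s => (f s)^-1) (- (f t) ^- 2 * a).
Proof.
move=> ft0 fa; have [df ea] := fa.
by split; [exact: derivableV | rewrite deriveV // ea].
Qed.

Lemma has_deriv_bigsum (I : Type) (r : seq I) (P : pred I) t
    (F : I -> K -> K) (dF : I -> K) :
  (forall i, has_deriv t (F i) (dF i)) ->
  has_deriv t (fun s => \sum_(i <- r | P i) F i s) (\sum_(i <- r | P i) dF i).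
Proof.
move=> hF; elim: r => [|i r ih].
  under eq_fun do rewrite big_nil.
  by rewrite big_nil; exact: has_deriv_const.
under eq_fun do rewrite big_cons.
by rewrite big_cons; case: (P i) => //; exact: has_deriv_add.
Qed.

End Calculus.

(* Subtraction is tried before addition: [x - y] also unifies with a sum. *)
Ltac derive_rules :=
  repeat first
    [ eassumption
    | match goal with H : forall _, has_deriv _ _ _ |- _ => exact: H end
    | apply: has_deriv_const | apply: has_deriv_sub | apply: has_deriv_add
    | apply: has_deriv_mul ].

Ltac derive := apply: has_deriv_eq; [by derive_rules | cbv beta].

(** * Partial derivatives of sums over indices and over pairs of indices *)

Section Slices.
Variables (K : numFieldType) (n : nat).
Implicit Types (v : 'I_n -> K) (i : 'I_n) (t : K).

Definition slice v i (s : K) : 'I_n -> K := @dfwith _ (fun=> K) v i s.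

Lemma slice_id v i : slice v i (v i) = v.
Proof. by apply/funext => j; rewrite /slice; case: dfwithP. Qed.

Lemma has_deriv_slice v i j :
  has_deriv (v i) (fun s => slice v i s j) (j == i)%:R.
Proof.
rewrite /slice; have [->|ji] := eqVneq j i.
  under eq_fun do rewrite dfwithin.
  exact: is_derive_id.
under eq_fun do rewrite dfwithout 1?eq_sym //.
exact: has_deriv_const.
Qed.

Lemma partialP (F : ('I_n -> K) -> K) v i c :
  has_deriv (v i) (fun s => F (slice v i s)) c -> partial F v i = c.
Proof. by case=> _ <-; rewrite /partial derive1E. Qed.

Lemma sum_delta i (c : 'I_n -> K) : \sum_j (j == i)%:R * c j = c i.
Proof.
rewrite (bigD1 i) //= eqxx mul1r big1 ?addr0 // => j /negbTE ->.
by rewrite mul0r.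
Qed.

(** Along the slice in direction i only the terms involving the i-th coordinate
vary, so the derivative of the sum is a single term. *)
Lemma has_deriv_sum_delta t i (F : 'I_n -> K -> K) (c : 'I_n -> K) :
  (forall j, has_deriv t (F j) ((j == i)%:R * c j)) ->
  has_deriv t (fun s => \sum_j F j s) (c i).
Proof. by move=> hF; rewrite -sum_delta; exact: has_deriv_bigsum. Qed.

(** In a sum over pairs j < l the i-th coordinate occurs as the smaller index,
contributing A, and as the larger index, contributing B. *)
Lemma has_deriv_pairs_delta t i (F : 'I_n -> 'I_n -> K -> K)
    (A B : 'I_n -> 'I_n -> K) :
  (forall j l, has_deriv t (F j l)
     ((j == i)%:R * A j l + (l == i)%:R * B j l)) ->
  has_deriv t (fun s => \sum_(j < n) \sum_(l < n | (j < l)%N) F j l s)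
    (\sum_(l < n | (i < l)%N) A i l + \sum_(j < n | (j < i)%N) B j i).
Proof.
move=> hF.
have -> : \sum_(l < n | (i < l)%N) A i l + \sum_(j < n | (j < i)%N) B j i =
    \sum_(j < n) \sum_(l < n | (j < l)%N)
      ((j == i)%:R * A j l + (l == i)%:R * B j l).
  under [RHS]eq_bigr do rewrite big_split /=.
  rewrite big_split /=; congr (_ + _).
    rewrite -(sum_delta i (fun j => \sum_(l < n | (j < l)%N) A j l)).
    by apply: eq_bigr => j _; rewrite mulr_sumr.
  rewrite big_mkcond /=; apply: eq_bigr => j _.
  rewrite big_mkcond /=.
  rewrite -(sum_delta i (fun l => if (j < l)%N then B j l else 0)).
  by apply: eq_bigr => l _; case: ifP => // _; rewrite mulr0.
by apply: has_deriv_bigsum => j; apply: has_deriv_bigsum.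
Qed.

End Slices.

(** * Gradients of the Hamiltonians *)

Section Gradients.
Variable K : numFieldType.

Section Even.
Variables (n : nat) (alpha : 'I_(2 * n).+1 -> K).
Implicit Types (q p : 'I_n -> K) (x : K) (i : 'I_n).

Lemma partial_p_even q p x i :
  partial (fun v => H_even alpha q v x) p i =
  q i * (x - \sum_j q j - 2 * p i - \sum_(j < n | (i < j)%N) q j
         + \sum_(j < n | (j < i)%N) q j) + cyc alpha (2 * i.+1)%N.
Proof.
have dw := has_deriv_slice p i; apply: partialP.
have d1 : has_deriv (p i) (fun s => \sum_j q j * slice p i s j) (q i).
  by apply: (has_deriv_sum_delta (c := q)) => j; derive; ring.
have d2 : has_deriv (p i) (fun s => \sum_j q j * slice p i s j ^+ 2)
    (2 * (q i * p i)).
  apply: (has_deriv_sum_delta (c := fun j => 2 * (q j * p j))) => j.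
  by derive; rewrite slice_id; ring.
have d3 : has_deriv (p i) (fun s => \sum_(j < n) \sum_(l < n | (j < l)%N)
      q j * (slice p i s j - slice p i s l) * q l)
    (\sum_(l < n | (i < l)%N) q i * q l + \sum_(j < n | (j < i)%N) - q j * q i).
  apply: (has_deriv_pairs_delta (A := fun j l => q j * q l)
           (B := fun j l => - q j * q l)) => j l.
  by derive; ring.
have d4 : has_deriv (p i)
    (fun s => \sum_(j < n) cyc alpha (2 * j.+1)%N * slice p i s j)
    (cyc alpha (2 * i.+1)%N).
  apply: (has_deriv_sum_delta (c := fun j => cyc alpha (2 * (j : 'I_n).+1)%N)).
  by move=> j; derive; ring.
rewrite /H_even; derive.
by rewrite -mulr_sumr -mulr_suml sumrN; ring.
Qed.

Lemma partial_q_even q p x i :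
  partial (fun v => H_even alpha v p x) q i =
  (x - \sum_j q j) * p i - \sum_j q j * p j - p i ^+ 2
  - \sum_(j < n | (i < j)%N) q j * (p i - p j)
  - \sum_(j < n | (j < i)%N) q j * (p j - p i)
  - \sum_(1 <= r < i.+2) cyc alpha (2 * r - 1)%N.
Proof.
have dw := has_deriv_slice q i; apply: partialP.
have d0 : has_deriv (q i) (fun s => \sum_j slice q i s j) 1.
  by apply: (has_deriv_sum_delta (c := fun=> 1)) => j; rewrite mulr1.
have d1 : has_deriv (q i) (fun s => \sum_j slice q i s j * p j) (p i).
  by apply: (has_deriv_sum_delta (c := p)) => j; derive; ring.
have d2 : has_deriv (q i) (fun s => \sum_j slice q i s j * p j ^+ 2) (p i ^+ 2).
  by apply: (has_deriv_sum_delta (c := fun j => p j ^+ 2)) => j; derive; ring.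
have d3 : has_deriv (q i) (fun s => \sum_(j < n) \sum_(l < n | (j < l)%N)
      slice q i s j * (p j - p l) * slice q i s l)
    (\sum_(l < n | (i < l)%N) q l * (p i - p l)
     + \sum_(j < n | (j < i)%N) q j * (p j - p i)).
  apply: (has_deriv_pairs_delta (A := fun j l => q l * (p j - p l))
           (B := fun j l => q j * (p j - p l))) => j l.
  by derive; rewrite slice_id; ring.
have d4 : has_deriv (q i) (fun s => \sum_(j < n)
      (\sum_(1 <= r < j.+2) cyc alpha (2 * r - 1)%N) * slice q i s j)
    (\sum_(1 <= r < i.+2) cyc alpha (2 * r - 1)%N).
  apply: (has_deriv_sum_delta
    (c := fun j : 'I_n => \sum_(1 <= r < j.+2) cyc alpha (2 * r - 1)%N)) => j.
  by derive; ring.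
rewrite /H_even; derive.
by rewrite slice_id; ring.
Qed.

End Even.

Section Odd.
Variables (n : nat) (alpha : 'I_(2 * n).+2 -> K).
Implicit Types (q p : 'I_n -> K) (x : K * K) (i : 'I_n).

Lemma partial_p_odd q p x i :
  partial (fun v => H_odd alpha q v x) p i =
  q i * ((x.1 ^+ 2 - \sum_j q j) * (x.2 / x.1 - 2 * p i)
         - \sum_(j < n | (i < j)%N) q j * (x.2 / x.1 + 2 * (p i - p j))
         + \sum_(j < n | (j < i)%N) q j * (x.2 / x.1 + 2 * (p j - p i))
         + 2 * gamma_odd alpha)
  + x.1 ^+ 2 * cyc alpha (2 * i.+1)%N.
Proof.
have dw := has_deriv_slice p i; apply: partialP.
rewrite /H_odd; set X := x.2 / x.1.
have d1 : has_deriv (p i) (fun s => \sum_j q j * slice p i s j) (q i).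
  by apply: (has_deriv_sum_delta (c := q)) => j; derive; ring.
have d2 : has_deriv (p i)
    (fun s => \sum_j q j * slice p i s j * (X - slice p i s j))
    (q i * (X - 2 * p i)).
  apply: (has_deriv_sum_delta (c := fun j => q j * (X - 2 * p j))) => j.
  by derive; rewrite slice_id; ring.
have d3 : has_deriv (p i) (fun s => \sum_(j < n) \sum_(l < n | (j < l)%N)
      q j * q l * (slice p i s j - slice p i s l)
      * (X + slice p i s j - slice p i s l))
    (\sum_(l < n | (i < l)%N) q i * (q l * (X + 2 * (p i - p l)))
     + \sum_(j < n | (j < i)%N) - q i * (q j * (X + 2 * (p j - p i)))).
  apply: (has_deriv_pairs_delta
    (A := fun j l => q j * (q l * (X + 2 * (p j - p l))))
    (B := fun j l => - q l * (q j * (X + 2 * (p j - p l))))) => j l.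
  by derive; rewrite slice_id; ring.
have d4 : has_deriv (p i)
    (fun s => \sum_(j < n) cyc alpha (2 * j.+1)%N * slice p i s j)
    (cyc alpha (2 * i.+1)%N).
  apply: (has_deriv_sum_delta (c := fun j => cyc alpha (2 * (j : 'I_n).+1)%N)).
  by move=> j; derive; ring.
derive.
by rewrite -!mulr_sumr; ring.
Qed.

Lemma partial_q_odd q p x i :
  partial (fun v => H_odd alpha v p x) q i =
  (x.1 ^+ 2 - \sum_j q j) * (p i * (x.2 / x.1 - p i))
  - \sum_j q j * p j * (x.2 / x.1 - p j)
  - \sum_(j < n | (i < j)%N) q j * ((p i - p j) * (x.2 / x.1 + p i - p j))
  - \sum_(j < n | (j < i)%N) q j * ((p j - p i) * (x.2 / x.1 + p j - p i))
  + 2 * gamma_odd alpha * p i - x.2 / x.1 * beta_odd alpha i.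
Proof.
have dw := has_deriv_slice q i; apply: partialP.
rewrite /H_odd; set X := x.2 / x.1.
have d0 : has_deriv (q i) (fun s => \sum_j slice q i s j) 1.
  by apply: (has_deriv_sum_delta (c := fun=> 1)) => j; rewrite mulr1.
have d1 : has_deriv (q i) (fun s => \sum_j slice q i s j * p j) (p i).
  by apply: (has_deriv_sum_delta (c := p)) => j; derive; ring.
have d2 : has_deriv (q i) (fun s => \sum_j slice q i s j * p j * (X - p j))
    (p i * (X - p i)).
  apply: (has_deriv_sum_delta (c := fun j => p j * (X - p j))) => j.
  by derive; ring.
have d3 : has_deriv (q i) (fun s => \sum_(j < n) \sum_(l < n | (j < l)%N)
      slice q i s j * slice q i s l * (p j - p l) * (X + p j - p l))
    (\sum_(l < n | (i < l)%N) q l * ((p i - p l) * (X + p i - p l))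
     + \sum_(j < n | (j < i)%N) q j * ((p j - p i) * (X + p j - p i))).
  apply: (has_deriv_pairs_delta
    (A := fun j l => q l * ((p j - p l) * (X + p j - p l)))
    (B := fun j l => q j * ((p j - p l) * (X + p j - p l)))) => j l.
  by derive; rewrite slice_id; ring.
have d4 : has_deriv (q i) (fun s => \sum_j beta_odd alpha j * slice q i s j)
    (beta_odd alpha i).
  by apply: (has_deriv_sum_delta (c := beta_odd alpha)) => j; derive; ring.
derive.
by rewrite slice_id; ring.
Qed.

End Odd.
End Gradients.

(** * Partial sums over even and odd indices *)

Section PartialSums.
Variable K : comNzRingType.
Implicit Types (g G : nat -> K) (m i : nat).

Definition evens g m : K := \sum_(0 <= r < m) g (2 * r)%N.
Definition odds g m : K := \sum_(0 <= r < m) g (2 * r + 1)%N.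
(** The sum of the products g_(2r) g_(2s+1) over s < r < m.  The products with
r <= s < m are the remaining ones in [evens g m * odds g m], which is why no
separate name is given to their sum. *)
Definition cross g m : K := \sum_(0 <= r < m) g (2 * r)%N * odds g r.
(** The squares p_j^2 in the Hamiltonian of odd rank produce these sums. *)
Definition cross2 g m : K := \sum_(0 <= r < m) g (2 * r)%N * odds g r ^+ 2.

Lemma evens0 g : evens g 0 = 0. Proof. exact: big_nil. Qed.
Lemma odds0 g : odds g 0 = 0. Proof. exact: big_nil. Qed.
Lemma cross0 g : cross g 0 = 0. Proof. exact: big_nil. Qed.
Lemma cross20 g : cross2 g 0 = 0. Proof. exact: big_nil. Qed.

Lemma evensS g m : evens g m.+1 = evens g m + g (2 * m)%N.
Proof. exact: big_nat_recr. Qed.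
Lemma oddsS g m : odds g m.+1 = odds g m + g (2 * m + 1)%N.
Proof. exact: big_nat_recr. Qed.
Lemma crossS g m : cross g m.+1 = cross g m + g (2 * m)%N * odds g m.
Proof. exact: big_nat_recr. Qed.
Lemma cross2S g m : cross2 g m.+1 = cross2 g m + g (2 * m)%N * odds g m ^+ 2.
Proof. exact: big_nat_recr. Qed.

Definition psumS := (evensS, oddsS, crossS, cross2S).
Definition psum0 := (evens0, odds0, cross0, cross20).

Lemma odds_shift g m : \sum_(1 <= r < m.+1) g (2 * r - 1)%N = odds g m.
Proof. by rewrite big_add1 /=; apply: eq_bigr => r _; congr g; lia. Qed.

Lemma sum_parity g m : \sum_(0 <= r < 2 * m) g r = evens g m + odds g m.
Proof.
elim: m => [|m ih]; first by rewrite big_nil !psum0 addr0.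
have -> : (2 * m.+1 = (2 * m).+2)%N by lia.
by rewrite !big_nat_recr //= ih !psumS addn1; ring.
Qed.

Lemma sum_window G i m :
  \sum_(0 <= r < m) G (i + r)%N =
  \sum_(0 <= r < i + m) G r - \sum_(0 <= r < i) G r.
Proof.
elim: m => [|m ih]; first by rewrite big_nil addn0 subrr.
by rewrite addnS !big_nat_recr //= ih; ring.
Qed.

Lemma evens_window g i m :
  \sum_(0 <= r < m) g (2 * (i + r))%N = evens g (i + m) - evens g i.
Proof. exact: (sum_window (fun r => g (2 * r)%N)). Qed.

Lemma odds_window g i m :
  \sum_(0 <= r < m) g (2 * (i + r) + 1)%N = odds g (i + m) - odds g i.
Proof. exact: (sum_window (fun r => g (2 * r + 1)%N)). Qed.

(** Summing over the smaller index r first leaves, for each s, a window of the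
A r, which is a difference of partial sums. *)
Lemma sum_triangle (A B : nat -> K) m :
  \sum_(1 <= r < m.+1) \sum_(r <= s < m.+1) A r * B s =
  \sum_(0 <= s < m) (\sum_(0 <= r < s.+1) A r.+1) * B s.+1.
Proof.
elim: m => [|m ih]; first by rewrite !big_geq.
rewrite [RHS]big_nat_recr //= -ih big_nat_recr //= big_nat1.
rewrite [X in _ = _ + X * _](big_nat_recr m) //= mulrDl addrA; congr (_ + _).
rewrite -[in X in _ = _ + X](big_add1 _ _ 0 m.+1 xpredT A) mulr_suml -big_split.
apply: eq_big_nat => r /andP[_ rm] /=.
by rewrite big_nat_recr //=; lia.
Qed.

(** For an odd period 2n+1, going once around the cycle exchanges the parities
of the indices. *)
Section PeriodOdd.
Variables (n : nat) (g : nat -> K).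
Hypothesis gper : forall m, g ((2 * n).+1 + m)%N = g m.

Lemma evens_wrap_odd m : evens g (n.+1 + m) = evens g n.+1 + odds g m.
Proof.
elim: m => [|m ih]; first by rewrite addn0 odds0 addr0.
rewrite addnS evensS ih oddsS -addrA; congr (_ + (_ + _)).
by rewrite -[in RHS]gper; congr g; lia.
Qed.

Lemma odds_wrap_odd m : odds g (n + m) = odds g n + evens g m.
Proof.
elim: m => [|m ih]; first by rewrite addn0 evens0 addr0.
rewrite addnS oddsS ih evensS -addrA; congr (_ + (_ + _)).
by rewrite -[in RHS]gper; congr g; lia.
Qed.

End PeriodOdd.

(** For an even period 2n+2 the parities are preserved, and each turn adds the
full sum over one parity. *)
Section PeriodEven.
Variables (n : nat) (g : nat -> K).
Hypothesis gper : forall m, g ((2 * n).+2 + m)%N = g m.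

Let g_even m : g (2 * (n.+1 + m))%N = g (2 * m)%N.
Proof. by rewrite -[in RHS]gper; congr g; lia. Qed.

Let g_odd m : g (2 * (n.+1 + m) + 1)%N = g (2 * m + 1)%N.
Proof. by rewrite -[in RHS]gper; congr g; lia. Qed.

Lemma evens_wrap_even m : evens g (n.+1 + m) = evens g n.+1 + evens g m.
Proof.
elim: m => [|m ih]; first by rewrite addn0 evens0 addr0.
by rewrite addnS evensS [evens g m.+1]evensS ih g_even addrA.
Qed.

Lemma odds_wrap_even m : odds g (n.+1 + m) = odds g n.+1 + odds g m.
Proof.
elim: m => [|m ih]; first by rewrite addn0 odds0 addr0.
by rewrite addnS oddsS [odds g m.+1]oddsS ih g_odd addrA.
Qed.

Lemma cross_wrap_even m :
  cross g (n.+1 + m) = cross g n.+1 + cross g m + odds g n.+1 * evens g m.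
Proof.
elim: m => [|m ih]; first by rewrite addn0 cross0 evens0 mulr0 !addr0.
rewrite addnS crossS [cross g m.+1]crossS [evens g m.+1]evensS ih g_even.
by rewrite odds_wrap_even; ring.
Qed.

(** The terms are g_(2t) (S(t) - S(i)), with S = odds g and t in a window of
length n+1 starting at i (the term t = i is zero).  They sum to a difference of
values of cross, and unwrapping this around the cycle gives the formula. *)
Lemma sum_triangle_oe i :
  \sum_(1 <= r < n.+1) \sum_(r <= s < n.+1)
     g (2 * (i + r) - 1)%N * g (2 * (i + s))%N =
  cross g n.+1 + odds g n.+1 * evens g i - odds g i * evens g n.+1.
Proof.
rewrite (sum_triangle (fun r => g (2 * (i + r) - 1)%N)
                      (fun s => g (2 * (i + s))%N)).
suff H m : \sum_(0 <= s < m) (\sum_(0 <= r < s.+1) g (2 * (i + r.+1) - 1)%N)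
                               * g (2 * (i + s.+1))%N =
    cross g (i + m.+1) - cross g i
    - odds g i * (evens g (i + m.+1) - evens g i).
  by rewrite H [(i + _)%N]addnC cross_wrap_even evens_wrap_even; ring.
elim: m => [|m ih].
  by rewrite big_geq // addn1 crossS evensS; ring.
rewrite big_nat_recr //= ih.
have -> : \sum_(0 <= r < m.+1) g (2 * (i + r.+1) - 1)%N =
    odds g (i + m.+1) - odds g i.
  by rewrite -odds_window; apply: eq_bigr => r _; congr g; lia.
by rewrite [(i + m.+2)%N]addnS crossS evensS; ring.
Qed.

(** The same with the parities exchanged: the companion
[evens * odds - cross] of cross now measures the sum. *)
Lemma sum_triangle_eo i :
  \sum_(1 <= r < n.+1) \sum_(r <= s < n.+1)
     g (2 * (i + r))%N * g (2 * (i + s) + 1)%N =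
  evens g n.+1 * odds g n.+1 - cross g n.+1
  + evens g n.+1 * odds g i - evens g i.+1 * odds g n.+1.
Proof.
rewrite (sum_triangle (fun r => g (2 * (i + r))%N)
                      (fun s => g (2 * (i + s) + 1)%N)).
suff H m : \sum_(0 <= s < m) (\sum_(0 <= r < s.+1) g (2 * (i + r.+1))%N)
                               * g (2 * (i + s.+1) + 1)%N =
    (evens g (i + m.+1) * odds g (i + m.+1) - cross g (i + m.+1))
    - (evens g i * odds g i - cross g i)
    - evens g i.+1 * (odds g (i + m.+1) - odds g i).
  rewrite H [(i + _)%N]addnC cross_wrap_even evens_wrap_even odds_wrap_even.
  by ring.
elim: m => [|m ih].
  by rewrite big_geq // addn1 !psumS; ring.
rewrite big_nat_recr //= ih.
have -> : \sum_(0 <= r < m.+1) g (2 * (i + r.+1))%N =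
    evens g (i + m.+2) - evens g i.+1.
  rewrite -addSnnS -evens_window.
  by apply: eq_bigr => r _; congr g; lia.
by rewrite [(i + m.+2)%N]addnS !psumS; ring.
Qed.

End PeriodEven.
End PartialSums.

(** * Sums over the canonical coordinates *)

Section OrdinalSums.
Variables (K : comNzRingType) (n : nat).
Implicit Types (G : nat -> K) (i : 'I_n).

Lemma sum_ord_all G : \sum_(j < n) G j.+1 = \sum_(0 <= r < n.+1) G r - G 0.
Proof. by rewrite big_nat_recl // big_mkord addrC addKr. Qed.

Lemma sum_ord_below G i :
  \sum_(j < n | (j < i)%N) G j.+1 = \sum_(0 <= r < i.+1) G r - G 0.
Proof.
rewrite big_nat_recl // big_mkord [G 0 + _]addrC addrK.
by rewrite (big_ord_widen n (fun j => G j.+1)) // ltnW.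
Qed.

Lemma sum_ord_above G i :
  \sum_(j < n | (i < j)%N) G j.+1 =
  \sum_(0 <= r < n.+1) G r - \sum_(0 <= r < i.+2) G r.
Proof.
have := sum_ord_all G; rewrite (bigID (fun j : 'I_n => (i < j)%N)) /=.
have -> : \sum_(j < n | ~~ (i < j)%N) G j.+1 = \sum_(j < i.+1) G j.+1.
  rewrite (big_ord_widen n (fun j => G j.+1)) //.
  by apply: eq_bigl => j; rewrite -leqNgt ltnS.
move=> h.
have -> : \sum_(0 <= r < i.+2) G r = G 0 + \sum_(j < i.+1) G j.+1.
  by rewrite big_nat_recl // big_mkord.
by rewrite opprD addrA -h addrK.
Qed.

(** With q_j = g_(2j) and p_j = odds g j, up to scaling, every sum in the
gradients has terms of the shape q_j (a + b p_j + c p_j^2). *)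
Variables (g : nat -> K) (F : 'I_n -> K) (a b c : K).
Hypothesis hF : forall j : 'I_n,
  F j = a * g (2 * j.+1)%N + b * (g (2 * j.+1)%N * odds g j.+1)
        + c * (g (2 * j.+1)%N * odds g j.+1 ^+ 2).

Let G r := a * g (2 * r)%N + b * (g (2 * r)%N * odds g r)
           + c * (g (2 * r)%N * odds g r ^+ 2).

Let sumG m :
  \sum_(0 <= r < m) G r = a * evens g m + b * cross g m + c * cross2 g m.
Proof. by rewrite !big_split /= -!mulr_sumr. Qed.

Let G0 : G 0 = a * g 0.
Proof. by rewrite /G muln0 odds0; ring. Qed.

Lemma quad_sum_all : \sum_(j < n) F j =
  a * (evens g n.+1 - g 0) + b * cross g n.+1 + c * cross2 g n.+1.
Proof.
rewrite (eq_bigr (fun j : 'I_n => G j.+1)) => [|j _]; last exact: hF.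
by rewrite sum_ord_all sumG G0; ring.
Qed.

Lemma quad_sum_below i : \sum_(j < n | (j < i)%N) F j =
  a * (evens g i.+1 - g 0) + b * cross g i.+1 + c * cross2 g i.+1.
Proof.
rewrite (eq_bigr (fun j : 'I_n => G j.+1)) => [|j _]; last exact: hF.
by rewrite sum_ord_below sumG G0; ring.
Qed.

Lemma quad_sum_above i : \sum_(j < n | (i < j)%N) F j =
  a * (evens g n.+1 - evens g i.+2) + b * (cross g n.+1 - cross g i.+2)
  + c * (cross2 g n.+1 - cross2 g i.+2).
Proof.
rewrite (eq_bigr (fun j : 'I_n => G j.+1)) => [|j _]; last exact: hF.
by rewrite sum_ord_above !sumG; ring.
Qed.

End OrdinalSums.

(** * Cyclic indices *)

Section Cyclic.
Variables (T : Type) (l : nat) (f : 'I_l.+1 -> T).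

Lemma cyc_modDl m k : cyc f (m %% l.+1 + k)%N = cyc f (m + k)%N.
Proof. by congr f; apply: val_inj; rewrite /= modnDml. Qed.

Lemma cyc_period m : cyc f (l.+1 + m)%N = cyc f m.
Proof. by congr f; apply: val_inj; rewrite /= modnDl. Qed.

Lemma cyc_ord (j : 'I_l.+1) : cyc f j = f j.
Proof. by rewrite /cyc valZpK. Qed.

End Cyclic.

Lemma sum_ord_cyc (K : comNzRingType) l (f : 'I_l.+1 -> K) :
  \sum_j f j = \sum_(0 <= m < l.+1) cyc f m.
Proof. by rewrite big_mkord; apply: eq_bigr => j _; rewrite cyc_ord. Qed.

(** * Odd period: the vector field in Hamiltonian coordinates *)

Section EvenField.
Variables (K : numFieldType) (n : nat) (alpha f : 'I_(2 * n).+1 -> K).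

Let g := cyc f.
Let a := cyc alpha.
Let V := cyc (vf_even alpha f).
Let E := evens g n.+1.
Let P := odds g n.

Lemma sum_ord_even (h : 'I_(2 * n).+1 -> K) :
  \sum_j h j = evens (cyc h) n.+1 + odds (cyc h) n.
Proof.
rewrite sum_ord_cyc big_nat_recr //= sum_parity evensS.
by ring.
Qed.

(** The two sums are windows S(i+n) - S(i) and T(i+n+1) - T(i+1); the odd period
turns them into P + T(i) - S(i) and E + S(i) - T(i+1). *)
Lemma vf_even_at_even i :
  V (2 * i)%N = g (2 * i)%N * (P - E + evens g i + evens g i.+1 - 2 * odds g i)
                + a (2 * i)%N.
Proof.
rewrite /V /cyc /vf_even -/(cyc f _) -/(cyc alpha _) -/g -/a /=.
have -> : \sum_(1 <= r < n.+1) cyc f ((2 * i) %% (2 * n).+1 + 2 * r - 1)%N =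
    odds g (n + i) - odds g i.
  rewrite [(n + i)%N]addnC -odds_window big_add1 /=; apply: eq_big_nat => r _.
  by rewrite -addnBA ?muln_gt0 // cyc_modDl; congr cyc; lia.
have -> : \sum_(1 <= r < n.+1) cyc f ((2 * i) %% (2 * n).+1 + 2 * r)%N =
    evens g (n.+1 + i) - evens g i.+1.
  rewrite addSnnS [(n + _)%N]addnC -evens_window big_add1 /=.
  apply: eq_big_nat => r _.
  by rewrite cyc_modDl; congr cyc; lia.
rewrite (evens_wrap_odd (cyc_period f)) (odds_wrap_odd (cyc_period f)).
by rewrite -/E -/P; ring.
Qed.

Lemma vf_even_at_odd i :
  V (2 * i + 1)%N =
  g (2 * i + 1)%N * (E - P + odds g i + odds g i.+1 - 2 * evens g i.+1)
  + a (2 * i + 1)%N.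
Proof.
rewrite /V /cyc /vf_even -/(cyc f _) -/(cyc alpha _) -/g -/a /=.
have -> : \sum_(1 <= r < n.+1) cyc f ((2 * i + 1) %% (2 * n).+1 + 2 * r - 1)%N =
    evens g (n.+1 + i) - evens g i.+1.
  rewrite addSnnS [(n + _)%N]addnC -evens_window big_add1 /=.
  apply: eq_big_nat => r _.
  by rewrite -addnBA ?muln_gt0 // cyc_modDl; congr cyc; lia.
have -> : \sum_(1 <= r < n.+1) cyc f ((2 * i + 1) %% (2 * n).+1 + 2 * r)%N =
    odds g (n + i.+1) - odds g i.+1.
  rewrite [(n + _)%N]addnC -odds_window big_add1 /=.
  apply: eq_big_nat => r _.
  by rewrite cyc_modDl; congr cyc; lia.
rewrite (evens_wrap_odd (cyc_period f)) (odds_wrap_odd (cyc_period f)).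
by rewrite -/E -/P; ring.
Qed.

(** The terms g_(2i) (T(i) + T(i+1)) telescope to T(m)^2, since g_(2i) is the
increment of T; the mixed terms add up to cross. *)
Lemma evens_vf_even m :
  evens V m = (P - E) * evens g m + evens g m ^+ 2 - 2 * cross g m + evens a m.
Proof.
elim: m => [|m ih]; first by rewrite !psum0; ring.
by rewrite evensS ih vf_even_at_even !psumS; ring.
Qed.

Lemma odds_vf_even m :
  odds V m = (E - P) * odds g m + odds g m ^+ 2
             - 2 * (evens g m * odds g m - cross g m) + odds a m.
Proof.
elim: m => [|m ih]; first by rewrite !psum0; ring.
by rewrite oddsS ih vf_even_at_odd !psumS; ring.
Qed.

(** The quadratic parts of the even and odd partial sums cancel by Abel
summation. *)
Lemma sum_vf_even : \sum_j vf_even alpha f j = \sum_j alpha j.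
Proof.
rewrite !sum_ord_even evens_vf_even odds_vf_even -/g -/a.
by rewrite [cross _ n.+1]crossS -/E -/P /E evensS; ring.
Qed.

Let z := coord_even f.

Lemma pos_coord_even i : pos z i = g (2 * i.+1)%N. Proof. by []. Qed.

Lemma mom_coord_even (i : 'I_n) : mom z i = odds g i.+1.
Proof. exact: odds_shift. Qed.

Lemma aux_coord_even : aux z = E + P. Proof. exact: sum_ord_even. Qed.

Lemma hamilton_pos_even i :
  partial (fun v => H_even alpha (pos z) v (aux z)) (mom z) i =
  pos (coord_even (vf_even alpha f)) i.
Proof.
have -> : pos (coord_even (vf_even alpha f)) i = V (2 * i.+1)%N by [].
rewrite vf_even_at_even partial_p_even aux_coord_even mom_coord_even -/a.
rewrite pos_coord_even.
rewrite (quad_sum_all (g := g) (a := 1) (b := 0) (c := 0)); last first.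
  by move=> j; rewrite !mul0r !addr0 mul1r.
rewrite (quad_sum_above (g := g) (a := 1) (b := 0) (c := 0)); last first.
  by move=> j; rewrite !mul0r !addr0 mul1r.
rewrite (quad_sum_below (g := g) (a := 1) (b := 0) (c := 0)); last first.
  by move=> j; rewrite !mul0r !addr0 mul1r.
by rewrite -/E; ring.
Qed.

Lemma hamilton_mom_even i :
  - partial (fun v => H_even alpha v (mom z) (aux z)) (pos z) i =
  mom (coord_even (vf_even alpha f)) i.
Proof.
rewrite [RHS]odds_shift -/V odds_vf_even partial_q_even odds_shift -/a.
rewrite aux_coord_even mom_coord_even.
rewrite (quad_sum_all (g := g) (a := 1) (b := 0) (c := 0)); last first.
  by move=> j; rewrite !mul0r !addr0 mul1r.
rewrite (quad_sum_all (g := g) (a := 0) (b := 1) (c := 0)); last first.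
  by move=> j; rewrite mom_coord_even pos_coord_even; ring.
rewrite (quad_sum_above (g := g) (a := odds g i.+1) (b := - 1) (c := 0));
  last by move=> j; rewrite mom_coord_even pos_coord_even; ring.
rewrite (quad_sum_below (g := g) (a := - odds g i.+1) (b := 1) (c := 0));
  last by move=> j; rewrite mom_coord_even pos_coord_even; ring.
rewrite -/E [evens g i.+2]evensS [cross g i.+2]crossS.
by ring.
Qed.

End EvenField.

(** * Even period: the vector field in Hamiltonian coordinates *)

Section OddField.
Variables (K : numFieldType) (n : nat) (alpha f : 'I_(2 * n).+2 -> K).

Let g := cyc f.
Let a := cyc alpha.
Let V := cyc (vf_odd alpha f).
Let E := evens g n.+1.
Let O := odds g n.+1.
Let W := cross g n.+1.
Let k := \sum_j alpha j.

Lemma sum_ord_odd (h : 'I_(2 * n).+2 -> K) :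
  \sum_j h j = evens (cyc h) n.+1 + odds (cyc h) n.+1.
Proof.
rewrite sum_ord_cyc.
by have -> : ((2 * n).+2 = 2 * n.+1)%N by [lia]; exact: sum_parity.
Qed.

(** The linear part comes from the window of alpha: it is the full sum over even
indices without the i-th term, and likewise for f. *)
Lemma vf_odd_at_even i :
  V (2 * i)%N =
  g (2 * i)%N * (2 * W - E * O + O * (evens g i + evens g i.+1)
                 - 2 * E * odds g i)
  + (k / 2 - evens a n.+1) * g (2 * i)%N + a (2 * i)%N * E.
Proof.
rewrite /V /cyc /vf_odd -/(cyc f _) -/(cyc alpha _) -/g -/a /=.
set S1 := \sum_(1 <= r < _) _; set S2 := \sum_(1 <= r < _) \sum_(r <= s < _) _.
have -> : S1 = W + O * evens g i - odds g i * E.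
  rewrite -(sum_triangle_oe (cyc_period f)); apply: eq_big_nat => r /andP[r0 _].
  apply: eq_big_nat => s _; rewrite -addnBA ?muln_gt0 // /g !cyc_modDl.
  by congr (_ * _); congr cyc; lia.
have -> : S2 = E * O - W + E * odds g i - evens g i.+1 * O.
  rewrite -(sum_triangle_eo (cyc_period f)); apply: eq_big_nat => r _.
  apply: eq_big_nat => s _; rewrite -addnA /g !cyc_modDl.
  by congr (_ * _); congr cyc; lia.
have win (h : 'I_(2 * n).+2 -> K) :
    \sum_(1 <= r < n.+1) cyc h ((2 * i) %% (2 * n).+2 + 2 * r)%N =
    evens (cyc h) n.+1 + evens (cyc h) i - evens (cyc h) i.+1.
  rewrite -(evens_wrap_even (cyc_period h)) addSnnS [(n + _)%N]addnC.
  rewrite -evens_window big_add1 /=; apply: eq_big_nat => r _.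
  by rewrite cyc_modDl; congr cyc; lia.
by rewrite !win -/g -/a -/E -/k ![evens _ i.+1]evensS; ring.
Qed.

Lemma vf_odd_at_odd i :
  V (2 * i + 1)%N =
  g (2 * i + 1)%N * (E * O - 2 * W + E * (odds g i + odds g i.+1)
                     - 2 * O * evens g i.+1)
  + (k / 2 - odds a n.+1) * g (2 * i + 1)%N + a (2 * i + 1)%N * O.
Proof.
rewrite /V /cyc /vf_odd -/(cyc f _) -/(cyc alpha _) -/g -/a /=.
set S1 := \sum_(1 <= r < _) _; set S2 := \sum_(1 <= r < _) \sum_(r <= s < _) _.
have -> : S1 = E * O - W + E * odds g i - evens g i.+1 * O.
  rewrite -(sum_triangle_eo (cyc_period f)); apply: eq_big_nat => r /andP[r0 _].
  apply: eq_big_nat => s _; rewrite -addnBA ?muln_gt0 // /g !cyc_modDl.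
  by congr (_ * _); congr cyc; lia.
have -> : S2 = W + O * evens g i.+1 - odds g i.+1 * E.
  rewrite -(sum_triangle_oe (cyc_period f)); apply: eq_big_nat => r /andP[r0 _].
  apply: eq_big_nat => s _; rewrite -addnA /g !cyc_modDl.
  by congr (_ * _); congr cyc; lia.
have win (h : 'I_(2 * n).+2 -> K) :
    \sum_(1 <= r < n.+1) cyc h ((2 * i + 1) %% (2 * n).+2 + 2 * r)%N =
    odds (cyc h) n.+1 + odds (cyc h) i - odds (cyc h) i.+1.
  rewrite -(odds_wrap_even (cyc_period h)) addSnnS [(n + _)%N]addnC.
  rewrite -odds_window big_add1 /=; apply: eq_big_nat => r _.
  by rewrite cyc_modDl; congr cyc; lia.
by rewrite !win -/g -/a -/O -/k ![odds _ i.+1]oddsS; ring.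
Qed.

Lemma evens_vf_odd m :
  evens V m = (2 * W - E * O) * evens g m + O * evens g m ^+ 2
              - 2 * E * cross g m
              + (k / 2 - evens a n.+1) * evens g m + evens a m * E.
Proof.
elim: m => [|m ih]; first by rewrite !psum0; ring.
rewrite evensS ih vf_odd_at_even [evens g m.+1]evensS [cross g m.+1]crossS.
by rewrite [evens a m.+1]evensS; ring.
Qed.

Lemma odds_vf_odd m :
  odds V m = (E * O - 2 * W) * odds g m + E * odds g m ^+ 2
             - 2 * O * (evens g m * odds g m - cross g m)
             + (k / 2 - odds a n.+1) * odds g m + odds a m * O.
Proof.
elim: m => [|m ih]; first by rewrite !psum0; ring.
rewrite oddsS ih vf_odd_at_odd ![odds _ m.+1]oddsS [cross g m.+1]crossS.
by rewrite [evens g m.+1]evensS; ring.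
Qed.

Lemma x0_oddE (h : 'I_(2 * n).+2 -> K) : x0_odd h = evens (cyc h) n.+1.
Proof. by []. Qed.

Lemma x1_oddE (h : 'I_(2 * n).+2 -> K) : x1_odd h = odds (cyc h) n.+1.
Proof. by []. Qed.

Lemma x0_vf_odd : x0_odd (vf_odd alpha f) = k * x0_odd f / 2.
Proof. by rewrite !x0_oddE evens_vf_odd -/g -/E -/W; ring. Qed.

Lemma x1_vf_odd : x1_odd (vf_odd alpha f) = k * x1_odd f / 2.
Proof. by rewrite !x1_oddE odds_vf_odd -/g -/O -/E -/W; ring. Qed.

Let z := coord_odd f.

Lemma pos_coord_odd i : pos z i = E * g (2 * i.+1)%N. Proof. by []. Qed.

Lemma mom_coord_odd (i : 'I_n) : mom z i = E^-1 * odds g i.+1.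
Proof. by congr (_ * _); exact: odds_shift. Qed.

Lemma gamma_oddE : gamma_odd alpha = odds a n.+1 / 2.
Proof. by rewrite mulrC. Qed.

Let k_split : k = evens a n.+1 + odds a n.+1. Proof. exact: sum_ord_odd. Qed.

Hypothesis E0 : E != 0.

(** The right-hand side is the derivative of x_0 f_(2i), given
x_0' = k x_0 / 2. *)
Lemma hamilton_pos_odd i :
  partial (fun v => H_odd alpha (pos z) v (aux z)) (mom z) i =
  k / 2 * E * g (2 * i.+1)%N + E * V (2 * i.+1)%N.
Proof.
rewrite partial_p_odd vf_odd_at_even gamma_oddE mom_coord_odd pos_coord_odd -/a.
have -> : (aux z).1 = E by [].
have -> : (aux z).2 = O by [].
rewrite (quad_sum_all (g := g) (a := E) (b := 0) (c := 0)); last first.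
  by move=> j; rewrite pos_coord_odd; ring.
rewrite (quad_sum_above (g := g) (a := O + 2 * odds g i.+1)
  (b := - 2) (c := 0));
  last by move=> j; rewrite mom_coord_odd pos_coord_odd; field.
rewrite (quad_sum_below (g := g) (a := O - 2 * odds g i.+1) (b := 2) (c := 0));
  last by move=> j; rewrite mom_coord_odd pos_coord_odd; field.
rewrite -/E -/W [evens g i.+2]evensS [cross g i.+2]crossS k_split.
by field.
Qed.

(** The right-hand side is the derivative of x_0^-1 (f_1 + ... + f_(2i-1)),
given x_0' = k x_0 / 2. *)
Lemma hamilton_mom_odd i :
  - partial (fun v => H_odd alpha v (mom z) (aux z)) (pos z) i =
  - E ^- 2 * (k / 2 * E) * odds g i.+1 + E^-1 * odds V i.+1.
Proof.
rewrite partial_q_odd odds_vf_odd gamma_oddE mom_coord_odd /beta_odd odds_shift.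
rewrite -/a.
have -> : (aux z).1 = E by [].
have -> : (aux z).2 = O by [].
set S := odds g i.+1.
rewrite (quad_sum_all (g := g) (a := E) (b := 0) (c := 0)); last first.
  by move=> j; rewrite pos_coord_odd; ring.
rewrite (quad_sum_all (g := g) (a := 0) (b := O / E) (c := - E^-1)); last first.
  by move=> j; rewrite mom_coord_odd pos_coord_odd; field.
rewrite (quad_sum_above (g := g) (a := S * (O + S) / E)
  (b := - (O + 2 * S) / E) (c := E^-1));
  last by move=> j; rewrite mom_coord_odd pos_coord_odd; field.
rewrite (quad_sum_below (g := g) (a := - S * (O - S) / E)
  (b := (O - 2 * S) / E) (c := E^-1));
  last by move=> j; rewrite mom_coord_odd pos_coord_odd; field.
rewrite -/E -/W [evens g i.+2]evensS [cross g i.+2]crossS.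
rewrite [cross2 g i.+2]cross2S -/S k_split.
by field.
Qed.

End OddField.

(** * Recovering f from its coordinates *)

Section Decode.
Variables (K : comNzRingType) (n : nat).
Implicit Types (q p : 'I_n -> K) (E O : K) (g : nat -> K) (m : nat).

(** The entry of index 2m, from the entries q of positive even index and the sum
E of all entries of even index. *)
Definition evens_entry q E m : K :=
  if m is m'.+1 then oapp q 0 (insub m') else E - \sum_i q i.

(** The sum f_1 + f_3 + ... + f_(2m-1).  The default value O is reached at
m = n+1, where it stands for the sum of all entries of odd index. *)
Definition odds_sum p O m : K :=
  if m is m'.+1 then oapp p O (insub m') else 0.

(** For the odd period 2n+1 the entries of index at most 2n are decoded, which
do not see the value O. *)
Definition decode q p E O m : K :=
  if odd m then odds_sum p O m./2.+1 - odds_sum p O m./2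
  else evens_entry q E m./2.

Lemma evens_entry_ord q E (i : 'I_n) : evens_entry q E i.+1 = q i.
Proof. by rewrite /evens_entry valK. Qed.

Lemma odds_sum_ord p O (i : 'I_n) : odds_sum p O i.+1 = p i.
Proof. by rewrite /odds_sum valK. Qed.

Lemma odds_sum_last p O : odds_sum p O n.+1 = O.
Proof. by rewrite /odds_sum insubN //= ltnn. Qed.

Lemma decode_even q p E O m : decode q p E O (2 * m)%N = evens_entry q E m.
Proof. by rewrite /decode mul2n odd_double doubleK. Qed.

Lemma decode_odd q p E O m :
  decode q p E O (2 * m + 1)%N = odds_sum p O m.+1 - odds_sum p O m.
Proof.
by rewrite /decode mul2n addn1 /= odd_double uphalf_double.
Qed.

Lemma odds_decode q p E O m : odds (decode q p E O) m = odds_sum p O m.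
Proof.
elim: m => [|m ih]; first exact: odds0.
by rewrite oddsS ih decode_odd addrC subrK.
Qed.

Lemma evens_decode q p E O : evens (decode q p E O) n.+1 = E.
Proof.
rewrite /evens big_nat_recl // decode_even big_mkord.
rewrite (eq_bigr q) => [|i _]; first by rewrite /= subrK.
by rewrite decode_even evens_entry_ord.
Qed.

Lemma odds_sumE g O m : (m <= n.+1)%N -> (m = n.+1 -> O = odds g m) ->
  odds_sum (fun i : 'I_n => odds g i.+1) O m = odds g m.
Proof.
rewrite leq_eqVlt => /predU1P[-> hO|mn _].
  by rewrite odds_sum_last hO.
case: m mn => [|m] mn; first by rewrite odds0.
exact: (odds_sum_ord _ _ (Ordinal (mn : m < n)%N)).
Qed.

Lemma decodeE g O m : (m < (2 * n).+2)%N ->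
  (m = (2 * n).+1 -> O = odds g n.+1) ->
  decode (fun i : 'I_n => g (2 * i.+1)%N) (fun i : 'I_n => odds g i.+1)
    (evens g n.+1) O m = g m.
Proof.
move=> mn hO; have [h mE] : exists h, m = (2 * h + odd m)%N.
  by exists m./2; rewrite mul2n addnC odd_double_half.
case: (odd m) mE => mE.
- rewrite mE decode_odd !odds_sumE; first by rewrite oddsS addrC addKr.
  all: try lia.
  by move=> hn; rewrite hn; apply: hO; lia.
- rewrite mE addn0 decode_even; case: h mE => [|h] mE.
    by rewrite /= (sum_ord_all n (fun r => g (2 * r)%N)) subKr.
  have hn : (h < n)%N by lia.
  exact: (evens_entry_ord (fun i : 'I_n => g (2 * i.+1)%N) _ (Ordinal hn)).
Qed.

End Decode.

(** Decoding is linear, so it commutes with differentiation. *)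
Section DecodeDerivative.
Variables (K : numFieldType) (n : nat) (t : K).
Variables (q p : K -> 'I_n -> K) (E O : K -> K).
Variables (q' p' : 'I_n -> K) (E' O' : K).
Hypothesis hp : forall i, has_deriv t (fun s => p s i) (p' i).
Hypothesis hO : has_deriv t O O'.

Lemma has_deriv_odds_sum m :
  has_deriv t (fun s => odds_sum (p s) (O s) m) (odds_sum p' O' m).
Proof. by case: m => [|m] /=; [exact: has_deriv_const | case: insub]. Qed.

Hypothesis hq : forall i, has_deriv t (fun s => q s i) (q' i).
Hypothesis hE : has_deriv t E E'.

Lemma has_deriv_decode m :
  has_deriv t (fun s => decode (q s) (p s) (E s) (O s) m)
    (decode q' p' E' O' m).
Proof.
rewrite /decode; case: (odd m).
  by apply: has_deriv_sub; exact: has_deriv_odds_sum.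
case: (m./2) => [|r] /=; last by case: insub => //=; exact: has_deriv_const.
by apply: has_deriv_sub => //; exact: has_deriv_bigsum.
Qed.

End DecodeDerivative.

Lemma cyc_small (T : Type) l (G : nat -> T) m : (m < l.+1)%N ->
  cyc (fun j : 'I_l.+1 => G j) m = G m.
Proof. by move=> ml; rewrite /cyc /= modn_small. Qed.

Lemma phase_eq (K X : Type) n (z w : phase K X n) :
  pos z =1 pos w -> mom z =1 mom w -> aux z = aux w -> z = w.
Proof.
by case: z w => [q p x] [q' p' x'] /= /funext -> /funext -> ->.
Qed.

(** * The two equivalences *)

Section EvenEquivalence.
Variables (K : numFieldType) (n : nat).

(** The sum of the entries of even index is x - p_n, and p_n is
[odds_sum (mom z) 0 n], with value 0 when n = 0. *)
Definition decode_even_rank (z : phase K K n) (j : 'I_(2 * n).+1) : K :=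
  decode (pos z) (mom z) (aux z - odds_sum (mom z) 0 n) 0 j.

Lemma coord_evenK : cancel (@coord_even K n) decode_even_rank.
Proof.
move=> f; apply/funext => j; rewrite -[RHS]cyc_ord.
have jn := ltn_ord j.
rewrite -[RHS](@decodeE _ n (cyc f) 0 j); [|lia|lia].
rewrite /decode_even_rank.
have -> : mom (coord_even f) = fun i => odds (cyc f) i.+1.
  by apply/funext => i; exact: mom_coord_even.
by rewrite aux_coord_even odds_sumE ?addrK //; lia.
Qed.

Lemma decode_even_rankK : cancel decode_even_rank (@coord_even K n).
Proof.
move=> z; pose D := decode (pos z) (mom z) (aux z - odds_sum (mom z) 0 n) 0.
have gE m : (m < (2 * n).+1)%N -> cyc (decode_even_rank z) m = D m.
  exact: (@cyc_small _ _ D).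
have oddsE m : (m <= n)%N ->
    odds (cyc (decode_even_rank z)) m = odds_sum (mom z) 0 m.
  move=> mn.
  rewrite -[RHS](odds_decode (pos z) _ (aux z - odds_sum (mom z) 0 n)).
  by apply: eq_big_nat => r rm; rewrite gE //; lia.
apply: phase_eq => [i|i|].
- have := ltn_ord i; rewrite pos_coord_even => hi.
  by rewrite gE /D ?decode_even ?evens_entry_ord //; lia.
- by rewrite mom_coord_even oddsE ?odds_sum_ord.
- rewrite aux_coord_even oddsE //.
  rewrite -[in RHS](subrK (odds_sum (mom z) 0 n) (aux z)); congr (_ + _).
  rewrite -[RHS](evens_decode (pos z) (mom z) _ 0).
  by apply: eq_big_nat => r rm; rewrite gE //; lia.
Qed.

Lemma coord_even_bij : bijective (@coord_even K n).
Proof. exact: Bijective coord_evenK decode_even_rankK. Qed.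

(** The coordinate map is linear, and the Hamiltonian vector field is its value
on the original one; decoding is linear as well, so derivatives pass both
ways. *)
Lemma even_equivalence (alpha : 'I_(2 * n).+1 -> K) (D : set K)
    (f : K -> 'I_(2 * n).+1 -> K) :
  solves (vf_even alpha) D f <->
  solves_even_hamilton alpha D (fun t => coord_even (f t)).
Proof.
split=> [hf|[hz hx] t Dt j].
  split=> t Dt; have ht : forall j, has_deriv t (f^~ j) _ := hf t Dt.
    move=> i; cbv zeta; rewrite hamilton_pos_even hamilton_mom_even.
    by split; [exact: ht | apply: has_deriv_bigsum => r; exact: ht].
  by rewrite -(sum_vf_even alpha (f t)); exact: has_deriv_bigsum.
have hq i : has_deriv t (fun s => pos (coord_even (f s)) i)
    (pos (coord_even (vf_even alpha (f t))) i).
  by rewrite -hamilton_pos_even; have [] := hz t Dt i.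
have hp i : has_deriv t (fun s => mom (coord_even (f s)) i)
    (mom (coord_even (vf_even alpha (f t))) i).
  by rewrite -hamilton_mom_even; have [] := hz t Dt i.
have hX : has_deriv t (fun s => aux (coord_even (f s)))
    (aux (coord_even (vf_even alpha (f t)))).
  by rewrite [aux (coord_even (vf_even _ _))]sum_vf_even; exact: hx.
have hS := has_deriv_odds_sum hp (has_deriv_const t 0) n.
rewrite -[vf_even alpha (f t)]coord_evenK.
under eq_fun => s do rewrite -[f s]coord_evenK.
exact: has_deriv_decode hp (has_deriv_const t 0) hq (has_deriv_sub hX hS) j.
Qed.

End EvenEquivalence.

Section OddEquivalence.
Variables (K : numFieldType) (n : nat).

Definition decode_odd_rank (z : phase K (K * K) n) (j : 'I_(2 * n).+2) : K :=
  decode (fun i => (aux z).1^-1 * pos z i) (fun i => (aux z).1 * mom z i)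
    (aux z).1 (aux z).2 j.

Lemma decode_vector (h : 'I_(2 * n).+2 -> K) (j : 'I_(2 * n).+2) :
  decode (fun i : 'I_n => cyc h (2 * i.+1)%N)
    (fun i : 'I_n => odds (cyc h) i.+1) (x0_odd h) (x1_odd h) j = h j.
Proof. by rewrite decodeE ?cyc_ord. Qed.

Lemma coord_oddK (f : 'I_(2 * n).+2 -> K) : x0_odd f != 0 ->
  decode_odd_rank (coord_odd f) = f.
Proof.
move=> f0; apply/funext => j; rewrite -[RHS]decode_vector /decode_odd_rank.
congr decode; apply/funext => i; first by rewrite /= mulKf.
by rewrite mom_coord_odd /= mulVKf.
Qed.

Lemma decode_odd_rankK (z : phase K (K * K) n) : (aux z).1 != 0 ->
  coord_odd (decode_odd_rank z) = z.
Proof.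
move=> z0; pose D := decode (fun i => (aux z).1^-1 * pos z i)
  (fun i => (aux z).1 * mom z i) (aux z).1 (aux z).2.
have gE m : (m < (2 * n).+2)%N -> cyc (decode_odd_rank z) m = D m.
  exact: (@cyc_small _ _ D).
have oddsE m : (m <= n.+1)%N -> odds (cyc (decode_odd_rank z)) m =
    odds_sum (fun i => (aux z).1 * mom z i) (aux z).2 m.
  move=> mn; rewrite -[RHS](odds_decode (fun i => (aux z).1^-1 * pos z i) _
                             (aux z).1).
  by apply: eq_big_nat => r rm; rewrite gE //; lia.
have x0E : x0_odd (decode_odd_rank z) = (aux z).1.
  rewrite -[RHS](evens_decode (fun i => (aux z).1^-1 * pos z i)
    (fun i => (aux z).1 * mom z i) _ (aux z).2).
  by apply: eq_big_nat => r rm; rewrite gE //; lia.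
apply: phase_eq => [i|i|].
- have := ltn_ord i; rewrite pos_coord_odd -x0_oddE x0E => hi.
  rewrite gE /D ?decode_even ?evens_entry_ord; last by lia.
  exact: mulVKf.
- rewrite mom_coord_odd -x0_oddE x0E oddsE ?odds_sum_ord; first exact: mulKf.
  by rewrite ltnS ltnW.
- rewrite /= x0E x1_oddE oddsE // odds_sum_last.
  by case: (aux z).
Qed.

Lemma coord_odd_bij :
  set_bij [set g : 'I_(2 * n).+2 -> K | x0_odd g != 0]
    [set z : phase K (K * K) n | (aux z).1 != 0] (@coord_odd K n).
Proof.
split=> [g //|g h /set_mem g0 /set_mem h0 gh|z z0].
  by rewrite -(coord_oddK g0) -(coord_oddK h0) gh.
exists (decode_odd_rank z); last exact: decode_odd_rankK.
rewrite /= -[x0_odd _]/(aux (coord_odd (decode_odd_rank z))).1.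
by rewrite decode_odd_rankK.
Qed.

(** From f to the coordinates: product and quotient rule with x_0' = k x_0 / 2.
Back: the same rules give the derivatives of x_0^-1 q_i = f_(2i) and of
x_0 p_i, which are then decoded linearly. *)
Lemma odd_equivalence (alpha : 'I_(2 * n).+2 -> K) (D : set K)
    (f : K -> 'I_(2 * n).+2 -> K) :
  open D -> (forall t, D t -> x0_odd (f t) != 0) ->
  solves (vf_odd alpha) D f <->
  solves_odd_hamilton alpha D (fun t => coord_odd (f t)).
Proof.
move=> oD f0; pose k := \sum_j alpha j.
split=> [hf|[hz hx] t Dt j].
  have hx t : D t -> has_deriv t (fun s => x0_odd (f s)) (k * x0_odd (f t) / 2).
    move=> Dt; rewrite -(x0_vf_odd alpha).
    by apply: has_deriv_bigsum => r; exact: hf.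
  split=> t Dt; last first.
    split; first exact: hx.
    rewrite [X in is_derive _ _ _ X](_ : _ = x1_odd (vf_odd alpha (f t))).
      by apply: has_deriv_bigsum => r; exact: hf.
    by rewrite x1_vf_odd.
  move=> i; cbv zeta; have ft0 := f0 t Dt.
  rewrite hamilton_pos_odd // hamilton_mom_odd // -x0_oddE.
  have dx := hx t Dt; split.
    apply: (has_deriv_eq (has_deriv_mul dx (hf t Dt _))).
    by rewrite -[f t _]/(cyc (f t) _) -[vf_odd _ _ _]/(cyc _ _) /k; ring.
  have dS : has_deriv t (fun s => \sum_(1 <= r < i.+2) cyc (f s) (2 * r - 1)%N)
      (odds (cyc (vf_odd alpha (f t))) i.+1).
    by rewrite -odds_shift; apply: has_deriv_bigsum => r; exact: hf.
  apply: (has_deriv_eq (has_deriv_mul (has_deriv_inv ft0 dx) dS)).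
  by rewrite odds_shift /k; ring.
have ft0 := f0 t Dt; have [dx0 dx1] := hx t Dt.
pose z s := coord_odd (f s).
have d0 : has_deriv t (fun s => (aux (z s)).1) (k * x0_odd (f t) / 2) := dx0.
have dV := has_deriv_inv ft0 d0.
have hq i : has_deriv t (fun s => (aux (z s)).1^-1 * pos (z s) i)
    (cyc (vf_odd alpha (f t)) (2 * i.+1)%N).
  have [dq _] := hz t Dt i.
  apply: (has_deriv_eq (has_deriv_mul dV dq)).
  by rewrite hamilton_pos_odd // pos_coord_odd -!x0_oddE /= /k; field.
have hp i : has_deriv t (fun s => (aux (z s)).1 * mom (z s) i)
    (odds (cyc (vf_odd alpha (f t))) i.+1).
  have [_ dp] := hz t Dt i.
  apply: (has_deriv_eq (has_deriv_mul d0 dp)).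
  by rewrite hamilton_mom_odd // mom_coord_odd -!x0_oddE /= /k; field.
have d0' : has_deriv t (fun s => (aux (z s)).1) (x0_odd (vf_odd alpha (f t))).
  by rewrite x0_vf_odd.
have d1' : has_deriv t (fun s => (aux (z s)).2) (x1_odd (vf_odd alpha (f t))).
  by rewrite x1_vf_odd.
have := has_deriv_decode hp d1' hq d0' j; rewrite decode_vector.
(* Decoding inverts the coordinate map only where x_0 is nonzero, which holds
   on the neighbourhood D of t. *)
apply: near_eq_is_derive.
have : nbhs t D by exact: open_nbhs_nbhs.
apply: filterS => s Ds.
by rewrite -[LHS]/(decode_odd_rank (z s) j) coord_oddK //; exact: f0.
Qed.

End OddEquivalence.

Theorem theorem3p1 (R : realType) (n : nat) (hn : (0 < n)%N) :
  (bijective (@coord_even R[i] n) /\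
   forall (alpha : 'I_(2 * n).+1 -> R[i])
          (D : set R[i]^o) (f : R[i] -> 'I_(2 * n).+1 -> R[i]),
     open D ->
     (solves (vf_even alpha) D f <->
      solves_even_hamilton alpha D (fun t => coord_even (f t))))
  /\
  (set_bij [set g : 'I_(2 * n).+2 -> R[i] | x0_odd g != 0]
           [set z : phase R[i] (R[i] * R[i]) n | (aux z).1 != 0]
           (@coord_odd R[i] n) /\
   forall (alpha : 'I_(2 * n).+2 -> R[i])
          (D : set R[i]^o) (f : R[i] -> 'I_(2 * n).+2 -> R[i]),
     open D -> (forall t, D t -> x0_odd (f t) != 0) ->
     (solves (vf_odd alpha) D f <->
      solves_odd_hamilton alpha D (fun t => coord_odd (f t)))).
Proof.
split; split.
- exact: coord_even_bij.
- by move=> alpha D f _; exact: even_equivalence.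
- exact: coord_odd_bij.
- by move=> alpha D f oD; exact: odd_equivalence.
Qed.
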